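(* Let $R$ be a unique factorization domain with field of fractions $k$, and let $T(x,y)=\sum_{i,j}t_{i,j}x^iy^j\in R[x,y]$ be an $(n,r)$-Brylawski polynomial, where $n,r$ are integers with $r\geq 1$ and $n-r\geq 1$. Suppose that (i) neither $x-1$ nor $y-1$ divides $T(x,y)$; (ii) $t_{1,0}\neq 0$; and (iii) $\deg_x T+\deg_y T\in\{n,n+1\}$. If $T(x,y)=U(x,y)V(x,y)$ with $U,V\in R[x,y]$, then $U(x,y)$ or $V(x,y)$ is a constant (an element of $R$). In particular $T(x,y)$ is irreducible in $k[x,y]$; moreover, if $\gcd_{i,j}\{t_{i,j}\}=1$, then $T(x,y)$ is irreducible in $R[x,y]$.
   Context: For a commutative ring $R$, a polynomial $U(x,y)\in R[x,y]$ is called an $(n,r)$-Brylawski polynomial (with constant $c$) if $(y-1)^rU\big(\frac{y}{y-1},y\big)=cy^n$ for some non-negative integer $n$, some integer $r$ (possibly negative or larger than $n$), and some non-zero constant $c\in R$; equivalently $(x-1)^{n-r}U\big(x,\frac{x}{x-1}\big)=cx^n$. For $U=\sum u_{i,j}x^iy^j$, $\deg_x U=\max\{i:\exists j,\ u_{i,j}\neq 0\}$ and $\deg_y U=\max\{j:\exists i,\ u_{i,j}\neq 0\}$. *)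

(* Defs.v *)
From HB Require Import structures.
From mathcomp Require Import all_boot all_order all_algebra.
From mathcomp Require Export polyXY fraction.

Set Implicit Arguments.
Unset Strict Implicit.
Unset Printing Implicit Defensive.

Import GRing.Theory Num.Theory.
Local Open Scope ring_scope.

(* The library's %| and irreducible_poly on {poly A} are based on pseudo-     *)
(* division and do not give the ring-theoretic notions when A is not a field, *)
(* hence the elementwise definitions below.                                   *)

Definition ring_divides (A : comNzRingType) (a b : A) : Prop :=
  exists q, b = q * a.

Definition ring_irreducible (A : idomainType) (a : A) : Prop :=
  [/\ a != 0, a \isn't a GRing.unit &
      forall b c, a = b * c -> b \is a GRing.unit \/ c \is a GRing.unit].

Definition ring_associated (A : comUnitRingType) (a b : A) : Prop :=
  exists2 u, u \is a GRing.unit & b = u * a.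

Definition is_ufd (A : idomainType) : Prop :=
  (forall a : A, a != 0 -> a \isn't a GRing.unit ->
     exists2 s : seq A, {in s, forall p, ring_irreducible p} &
                        a = \prod_(p <- s) p) /\
  (forall s t : seq A,
     {in s, forall p, ring_irreducible p} ->
     {in t, forall p, ring_irreducible p} ->
     \prod_(p <- s) p = \prod_(p <- t) p ->
     exists2 t', perm_eq t' t &
       size s = size t' /\
       forall i, (i < size s)%N -> ring_associated s`_i t'`_i).

Definition is_family_gcd (A : comNzRingType) (I : Type) (f : I -> A) (g : A) :
    Prop :=
  (forall i, ring_divides g (f i)) /\
  (forall d, (forall i, ring_divides d (f i)) -> ring_divides d g).

(* R[x, y] is {poly {poly R}} with the conventions of polyXY: x is the outer  *)
(* variable 'X and y is the inner one 'Y, so the coefficient of x^i y^j in U  *)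
(* is U`_i`_j.                                                                *)

Definition degX (R : nzRingType) (U : {poly {poly R}}) : nat := (size U).-1.

Definition degY (R : nzRingType) (U : {poly {poly R}}) : nat := (sizeY U).-1.

Definition is_constXY (R : nzRingType) (U : {poly {poly R}}) : Prop :=
  exists a : R, U = a%:P%:P.

Definition map_polyXY (A B : nzRingType) (f : A -> B) (U : {poly {poly A}}) :
    {poly {poly B}} := map_poly (map_poly f) U.

(* U(f, y) in the field of fractions R(y) of R[y]. *)
Definition evalX_frac (R : idomainType) (U : {poly {poly R}})
    (f : {fraction {poly R}}) : {fraction {poly R}} :=
  (map_poly (@tofrac {poly R}) U).[f].

(* The identity (y - 1)^r U(y / (y - 1), y) = c y^n holds in R(y), with r an  *)
(* exponent in int.                                                           *)
Definition is_brylawski (R : idomainType) (n : nat) (r : int)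
    (U : {poly {poly R}}) : Prop :=
  let y : {fraction {poly R}} := tofrac 'X in
  exists2 c : R, c != 0 &
    (y - 1) ^ r * evalX_frac U (y / (y - 1)) = tofrac c%:P * y ^+ n.

(* Main.v *)
(* On the curve (x - 1)(y - 1) = 1, parametrized by x = y / (y - 1), the      *)
(* polynomial T restricts to c y^n (y - 1)^(-r); clearing denominators, a     *)
(* factor of T restricts to a y^i (y - 1)^k. As t_{1,0} <> 0, one of the      *)
(* factors, say U, has a nonzero constant term, which forces i = 0 for U, so  *)
(* that the other factor V carries all of y^n. Clearing denominators in V     *)
(* costs at most deg_x V + deg_y V, hence this sum is at least n, and         *)
(* deg_x U + deg_y U <= 1. A linear U is then a multiple of x - 1 or y - 1.   *)
(* The same argument applies over the field of fractions.                     *)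

Require Import Defs.
From HB Require Import structures.
From mathcomp Require Import all_boot all_order all_algebra.
From mathcomp Require Import zify.

Set Implicit Arguments.
Unset Strict Implicit.
Unset Printing Implicit Defensive.

Import GRing.Theory Num.Theory.
Local Open Scope ring_scope.

(** Clearing denominators in U(y / (y - 1), y) turns U into [curve_num U] in R[y]. This is
    multiplicative on nonzero polynomials ([curve_numM]), has degree at most deg_x U + deg_y U
    ([size_curve_num]), and its value at 0 is the constant term of U up to sign ([curve_num_at0]).
    For T it equals c y^n (y - 1)^m ([brylawski_curve_num]), so each factor of T yields a monomial
    in y and y - 1 ([mul_eq_CXnX1m]). Comparing degrees leaves only linear candidates for the factor
    with nonzero constant term, and [factor_is_constXY] excludes them. *)

Lemma mul_eq_CXnX1m (R : idomainType) (n m : nat) (c : R) (p q : {poly R}) :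
    c != 0 -> p * q = c%:P * 'X^n * ('X - 1) ^+ m ->
  exists a b i j k l, [/\ p = a%:P * 'X^i * ('X - 1) ^+ k,
    q = b%:P * 'X^j * ('X - 1) ^+ l & (i + j = n)%N].
Proof.
(* Each step strips one linear factor: 1 (or 0 once m = 0) is a root of p * q, hence of p or of q,
   and that monic factor is then cancelled. When both exponents are 0, a product of size 1 has
   constant factors. *)
move=> c0; elim: m p q => [|m IHm].
  elim: n => [|n IHn] p q.
    rewrite expr0 !mulr1 => pq.
    have : size (p * q) == 1%N by rewrite pq size_polyC c0.
    rewrite size_mul_eq1 => /andP[/size_poly1P[a _ ->] /size_poly1P[b _ ->]].
    by exists a, b, 0%N, 0%N, 0%N, 0%N; rewrite !expr0 !mulr1.
  rewrite expr0 mulr1 => pq.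
  have X0 : 'X != 0 :> {poly R} by rewrite polyX_eq0.
  have: root (p * q) 0 by rewrite pq rootE !hornerE expr0n mulr0.
  rewrite rootM => /orP[] /factor_theorem[s].
    rewrite subr0 => ps; have [] := IHn s q.
      by apply: (mulIf X0); rewrite expr0 mulr1 mulrAC -ps pq exprSr mulrA.
    move=> a [b [i [j [k [l [sE qE ij]]]]]].
    exists a, b, i.+1, j, k, l; split=> //; last by rewrite addSn ij.
    by rewrite ps sE exprSr mulrA mulrAC.
  rewrite subr0 => qs; have [] := IHn p s.
    by apply: (mulIf X0); rewrite expr0 mulr1 -mulrA -qs pq exprSr mulrA.
  move=> a [b [i [j [k [l [pE sE ij]]]]]].
  exists a, b, i, j.+1, k, l; split=> //; last by rewrite addnS ij.
  by rewrite qs sE exprSr mulrA mulrAC.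
move=> p q pq.
have X0 : 'X - 1 != 0 :> {poly R} by rewrite polyXsubC_eq0.
have: root (p * q) 1 by rewrite pq rootE !hornerE subrr expr0n mulr0.
rewrite rootM => /orP[] /factor_theorem[s]; rewrite polyC1 => se.
  have [] := IHm s q.
    by apply: (mulIf X0); rewrite mulrAC -se pq exprSr mulrA.
  move=> a [b [i [j [k [l [sE qE ij]]]]]].
  by exists a, b, i, j, k.+1, l; split=> //; rewrite se sE exprSr mulrA.
have [] := IHm p s.
  by apply: (mulIf X0); rewrite -(mulrA p) -se pq exprSr mulrA.
move=> a [b [i [j [k [l [pE sE ij]]]]]].
by exists a, b, i, j, k, l.+1; split=> //; rewrite se sE exprSr mulrA.
Qed.

(* $(y - 1)^{\deg_x U}\, U(y / (y - 1), y)$ *)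
Definition curve_num (R : nzRingType) (U : {poly {poly R}}) : {poly R} :=
  \sum_(i < size U) U`_i * 'X^i * ('X - 1) ^+ (degX U - i).

Lemma tofrac_curve_num (R : idomainType) (U : {poly {poly R}}) :
  let y : {fraction {poly R}} := tofrac 'X in
  tofrac (curve_num U) = (y - 1) ^+ degX U * evalX_frac U (y / (y - 1)).
Proof.
move=> y.
have y1 : y - 1 != 0.
  by rewrite -tofrac1 -tofracB tofrac_eq0 polyXsubC_eq0.
have injf : injective (@tofrac {poly R}).
  by move=> a b /eqP; rewrite tofrac_eq => /eqP.
rewrite /evalX_frac horner_coef size_map_inj_poly ?tofrac0 // mulr_sumr.
rewrite /curve_num rmorph_sum; apply: eq_bigr => i _.
rewrite coef_map /= !rmorphM !rmorphXn /= rmorphB /= rmorph1 -/y.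
(* The truncated exponent [degX U - i] is thus a true difference; the index i itself shows that U
   has positive size. *)
have le_i : (i <= degX U)%N.
  by rewrite /degX -ltnS prednK //; case: (size U) i => [[]|].
rewrite -{2}(subnK le_i) exprD expr_div_n.
by rewrite mulrACA [_ ^+ i * _]mulrCA divff ?expf_neq0 // mulr1 mulrC mulrA.
Qed.

Lemma degX_mul (R : idomainType) (U V : {poly {poly R}}) :
  U != 0 -> V != 0 -> degX (U * V) = (degX U + degX V)%N.
Proof.
move=> U0 V0; rewrite /degX size_mul //.
move: U0 V0; rewrite -!size_poly_gt0.
by move: (size U) (size V) => u v; lia.
Qed.

Lemma curve_numM (R : idomainType) (U V : {poly {poly R}}) :
  U != 0 -> V != 0 -> curve_num (U * V) = curve_num U * curve_num V.
Proof.
move=> U0 V0; apply/eqP; rewrite -tofrac_eq tofracM !tofrac_curve_num.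
by rewrite /evalX_frac rmorphM hornerM degX_mul // exprD mulrACA.
Qed.

Lemma curve_num_map (A B : idomainType) (f : {rmorphism A -> B})
    (U : {poly {poly A}}) :
  injective f -> curve_num (map_polyXY f U) = map_poly f (curve_num U).
Proof.
move=> injf; rewrite /curve_num /map_polyXY /degX.
rewrite size_map_inj_poly ?rmorph0 //; last exact: map_inj_poly (rmorph0 f).
rewrite rmorph_sum; apply: eq_bigr => i _.
by rewrite coef_map /= !rmorphM !rmorphXn /= rmorphB rmorph1 /= map_polyX.
Qed.

(** The term of index i has degree deg U_i + i + (deg_x U - i), in which i cancels. *)
Lemma size_curve_num (R : idomainType) (U : {poly {poly R}}) :
  (size (curve_num U) <= (degX U + degY U).+1)%N.
Proof.
apply: leq_trans (size_sum _ _ _) _; apply/bigmax_leqP => i _.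
have [->|Ui0] := eqVneq U`_i 0; first by rewrite !mul0r size_poly0.
rewrite size_mul ?mulf_neq0 ?expf_neq0 ?polyX_eq0 ?polyXsubC_eq0 //.
rewrite size_mul ?expf_neq0 ?polyX_eq0 // size_polyXn size_exp_XsubC.
have le_i : (i <= degX U)%N.
  by rewrite /degX -ltnS prednK //; case: (size U) i {Ui0} => [[]|].
move: (max_size_coefXY U i) Ui0; rewrite /degY -size_poly_gt0.
by move: (size (U`_i)%R) (degX U) (sizeY U) le_i => s d e; lia.
Qed.

(** At y = 0 only the term of index 0 survives. A nonzero constant term therefore keeps y from
    dividing [curve_num U]. *)
Lemma curve_num_at0 (R : idomainType) (U : {poly {poly R}}) :
  (curve_num U).[0] = U`_0`_0 * (-1) ^+ degX U.
Proof.
rewrite /curve_num horner_sum; case E: (size U) => [|m].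
  move/eqP: E; rewrite size_poly_eq0 big_ord0 => /eqP->.
  by rewrite !coef0 mul0r.
rewrite big_ord_recl big1 => [|i _]; last first.
  by rewrite !hornerE /= exprS mul0r mulr0 mul0r.
by rewrite !hornerE /= subn0 horner_coef0.
Qed.

Lemma brylawski_curve_num (R : idomainType) (n : nat) (r : int)
    (T : {poly {poly R}}) :
  is_brylawski n r T -> exists (c : R) (m : nat),
    c != 0 /\ curve_num T = c%:P * 'X^n * ('X - 1) ^+ m.
Proof.
case=> c c0; set y : {fraction {poly R}} := tofrac 'X => /= eqT.
have yX : y - 1 = tofrac ('X - 1) by rewrite tofracB tofrac1.
have y1 : y - 1 != 0 by rewrite yX tofrac_eq0 polyXsubC_eq0.
have PT := tofrac_curve_num T; rewrite /= -/y in PT.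
have X1 : 'X - 1 != 0 :> {poly R} by rewrite polyXsubC_eq0.
case: r eqT => k eqT; exists c.
  have E : ('X - 1) ^+ k * curve_num T = c%:P * 'X^n * ('X - 1) ^+ degX T.
    apply/eqP; rewrite -tofrac_eq !tofracM PT !tofracXn -yX -/y.
    by rewrite mulrCA [X in _ * X]eqT mulrC.
  (* Otherwise, after cancelling (y - 1)^(deg_x T), the left side of [E] vanishes at y = 1 while the
     right side is c. *)
  have le_kd : (k <= degX T)%N.
    rewrite leqNgt; apply/negP => lt_dk; move/eqP: c0; apply.
    move: E; rewrite -(subnK (ltnW lt_dk)) exprD mulrAC => /mulIf.
    move=> /(_ (expf_neq0 _ X1)) /(congr1 (horner^~ 1)).
    rewrite !hornerE subrr expr1n mulr1 => <-.
    by rewrite expr0n subn_eq0 leqNgt lt_dk mul0r.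
  exists (degX T - k)%N; split=> //.
  apply: (mulfI (expf_neq0 k X1)).
  by rewrite E mulrCA -exprD subnKC.
exists (degX T + k.+1)%N; split=> //.
apply/eqP; rewrite -tofrac_eq !tofracM PT !tofracXn -yX -/y.
rewrite -eqT NegzE -exprnN exprD mulrACA; apply/eqP.
by rewrite [RHS]mulrC -mulrA mulVKf ?expf_neq0 // mulrC.
Qed.

Lemma degY_swapXY (R : nzRingType) (U : {poly {poly R}}) :
  degY U = degX (swapXY U).
Proof. by rewrite /degY sizeYE. Qed.

Lemma degY_mul (R : idomainType) (U V : {poly {poly R}}) :
  U != 0 -> V != 0 -> degY (U * V) = (degY U + degY V)%N.
Proof. by move=> U0 V0; rewrite !degY_swapXY rmorphM degX_mul ?swapXY_eq0. Qed.

(** The Brylawski identity enters only through [curve_num], a form that transports along the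
    embedding of R in its field of fractions. The two root conditions say that x - 1 and y - 1 do
    not divide the product. *)
Lemma factor_is_constXY (R : idomainType) (n m : nat) (c : R)
    (U V : {poly {poly R}}) :
    c != 0 -> curve_num (U * V) = c%:P * 'X^n * ('X - 1) ^+ m ->
    ~~ root (U * V) 1 -> ~~ root (swapXY (U * V)) 1 ->
    (degX (U * V) + degY (U * V) <= n.+1)%N -> U`_0`_0 != 0 ->
  is_constXY U.
Proof.
move=> c0 cUV x1 y1 degUV u00.
have U0 : U != 0 by apply: contraNneq u00 => ->; rewrite !coef0.
have V0 : V != 0 by apply: contraNneq x1 => ->; rewrite mulr0 root0.
have sX1 k : size (('X - 1) ^+ k : {poly R}) = k.+1 by rewrite size_exp_XsubC.
have cUV0 : curve_num U * curve_num V != 0.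
  by rewrite -curve_numM // cUV !mulf_neq0 ?polyC_eq0 ?expf_neq0 ?polyX_eq0
    ?polyXsubC_eq0.
move: x1 y1 degUV; rewrite rmorphM !rootM !negb_or degX_mul // degY_mul //.
move=> /andP[x1 _] /andP[y1 _] degUV.
rewrite curve_numM // in cUV.
have [a [b [i [j [k [l [PU PV ij]]]]]]] := mul_eq_CXnX1m c0 cUV.
move: cUV0; rewrite PU PV !mulf_eq0 !negb_or !polyC_eq0.
move=> /andP[/andP[/andP[a0 _] _] /andP[/andP[b0 _] _]].
have i0 : i = 0%N.
  apply/eqP; apply: contraNT u00 => i0.
  have := curve_num_at0 U; rewrite PU !hornerE expr0n (negPf i0).
  by rewrite mulr0 mul0r => /esym/eqP; rewrite mulf_eq0 signr_eq0 orbF.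
have sU := size_curve_num U; have sV := size_curve_num V.
rewrite {}PV size_mul ?mulf_neq0 ?polyC_eq0 ?expf_neq0 ?polyX_eq0
  ?polyXsubC_eq0 // in sV.
rewrite mul_polyC size_scale // size_polyXn sX1 in sV.
rewrite PU i0 mulr1 mul_polyC size_scale // sX1 in sU.
(* As j = n, [curve_num V] has degree n + l, so V takes at least n of the total degree n + 1
   allowed; at most 1 remains for U, and it bounds k. *)
have k1 : (k <= 1)%N by lia.
have {ij sV degUV}degU : (degX U + degY U <= 1)%N by lia.
rewrite i0 mulr1 in PU.
case dX: (degX U) => [|[|d]]; last by lia.
  have Uc : U = (U`_0)%:P.
    by apply: size1_polyC; move: dX; rewrite /degX; case: (size U) => [|[]].
  have cU : curve_num U = U`_0.
    rewrite {1}Uc /curve_num /degX size_polyC.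
    have -> : U`_0 != 0 by apply: contraNneq u00 => ->; rewrite coef0.
    by rewrite big_ord_recl big_ord0 coefC /= !expr0 !mulr1 addr0.
  rewrite cU in PU; case: k k1 PU {sU} => [|[|//]] _ PU.
    by exists a; rewrite Uc PU expr0 mulr1.
  (* Here U = a (y - 1). *)
  case/negP: y1; rewrite rootE Uc /= swapXY_polyC PU expr1 -polyC1 horner_map.
  by rewrite !hornerE subrr mulr0.
have dY : degY U = 0%N by lia.
have Uc e : U`_e = (U`_e`_0)%:P.
  apply: size1_polyC; have := max_size_coefXY U e.
  by move: dY; rewrite /degY; case: (sizeY U) => [|[]] // _ /leq_trans->.
have s2 : size U = 2%N by move: dX; rewrite /degX; case: (size U) => // s /= ->.
have U1 : U`_1`_0 != 0.
  apply: contraTneq U0 => u1; rewrite -lead_coef_eq0 lead_coefE s2 Uc u1.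
  by rewrite eqxx.
have cU : curve_num U = U`_0 * ('X - 1) + U`_1 * 'X.
  rewrite /curve_num dX s2 big_ord_recl big_ord_recl big_ord0 /= addr0.
  by rewrite !expr0 !mulr1.
move: PU; rewrite cU (Uc 0%N) (Uc 1%N); case: k k1 {sU} => [|[|//]] _ PU.
  (* With k = 0, u_0 (y - 1) + u_1 y is constant, so u_0 + u_1 = 0 and U = u_1 (x - 1). *)
  case/negP: x1; rewrite rootE horner_coef s2 !big_ord_recl big_ord0 /=.
  rewrite !expr1n !mulr1 addr0 (Uc 0%N) (Uc 1%N) -polyCD polyC_eq0.
  move/(congr1 (fun p : {poly R} => p`_1)): PU.
  by rewrite expr0 mulr1 mulrBr mulr1 coefD coefB !coefMX !coefC /= subr0 => ->.
(* With k = 1, setting y = 1 gives u_1 = 0, against deg_x U = 1. *)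
move/(congr1 (horner^~ 1)): PU; rewrite !hornerE subrr !mulr0 add0r => /eqP.
by rewrite (negPf U1).
Qed.

(** Since t_{1,0} = u_{0,0} v_{1,0} + u_{1,0} v_{0,0} is nonzero, U or V has a nonzero constant
    term. *)
Lemma factors_is_constXY (R : idomainType) (n m : nat) (c : R)
    (U V : {poly {poly R}}) :
    c != 0 -> curve_num (U * V) = c%:P * 'X^n * ('X - 1) ^+ m ->
    ~~ root (U * V) 1 -> ~~ root (swapXY (U * V)) 1 ->
    (degX (U * V) + degY (U * V) <= n.+1)%N -> (U * V)`_1`_0 != 0 ->
  is_constXY U \/ is_constXY V.
Proof.
move=> c0 cUV x1 y1 degUV t10.
have [u0|u0] := eqVneq U`_0`_0 0; last first.
  by left; apply: factor_is_constXY cUV x1 y1 degUV u0.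
right; rewrite ![U * V]mulrC in cUV x1 y1 degUV.
apply: factor_is_constXY cUV x1 y1 degUV _ => //.
apply: contraNneq t10 => v0.
rewrite coefM !big_ord_recl big_ord0 /= addr0 coefD !coef0M.
by rewrite u0 v0 mul0r mulr0 addr0.
Qed.

Lemma root_X1 (R : comNzRingType) (T : {poly {poly R}}) :
  root T 1 <-> ring_divides ('X - 1) T.
Proof. by rewrite -polyC1; split=> /factor_theorem. Qed.

Lemma root_Y1 (R : comNzRingType) (T : {poly {poly R}}) :
  root (swapXY T) 1 <-> ring_divides ('Y - 1) T.
Proof.
rewrite root_X1; split=> -[q E]; exists (swapXY q).
  by rewrite -[T]swapXYK E rmorphM rmorphB rmorph1 /= swapXY_X.
by rewrite E rmorphM rmorphB rmorph1 /= swapXY_Y.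
Qed.

Theorem theorem2p10 (R : idomainType) (ufdR : is_ufd R)
    (n : nat) (r : int) (T : {poly {poly R}})
    (brylT : is_brylawski n r T)
    (r_ge1 : 1 <= r) (nr_ge1 : 1 <= n%:Z - r)
    (x1_ndvd : ~ ring_divides ('X - 1) T)
    (y1_ndvd : ~ ring_divides ('Y - 1) T)
    (t10_neq0 : T`_1`_0 != 0)
    (degT : (degX T + degY T = n)%N \/ (degX T + degY T = n.+1)%N) :
  [/\ forall U V : {poly {poly R}}, T = U * V ->
        is_constXY U \/ is_constXY V,
      ring_irreducible (map_polyXY (@tofrac R) T) &
      is_family_gcd (fun ij : nat * nat => T`_(ij.1)`_(ij.2)) 1 ->
        ring_irreducible T].
Proof.
have [c [m [c0 PT]]] := brylawski_curve_num brylT.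
have {}degT : (degX T + degY T <= n.+1)%N by lia.
have x1 : ~~ root T 1 by apply/negP => /root_X1.
have y1 : ~~ root (swapXY T) 1 by apply/negP => /root_Y1.
have irrT (U V : {poly {poly R}}) : T = U * V -> is_constXY U \/ is_constXY V.
  move=> TE; rewrite TE in PT degT x1 y1 t10_neq0.
  exact: factors_is_constXY PT _ _ _ _.
have nonconst (A : idomainType) (W : {poly {poly A}}) :
    W`_1`_0 != 0 -> W != 0 /\ W \isn't a GRing.unit.
  move=> w10; split; first by apply: contraNneq w10 => ->; rewrite !coef0.
  apply: contraNN w10; rewrite poly_unitE => /andP[/eqP sW _].
  by rewrite [W`_1]nth_default ?coef0 ?sW.
have T0 := nonconst _ _ t10_neq0.
split=> //.
  have inj1 : injective (@tofrac R).
    by move=> a b /eqP; rewrite tofrac_eq => /eqP.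
  have inj2 : injective (map_poly (@tofrac R)).
    by apply: map_inj_poly; rewrite ?tofrac0.
  set T' := map_polyXY _ _.
  have t10' : T'`_1`_0 != 0 by rewrite !coef_map /= tofrac_eq0.
  have [T'0 T'u] := nonconst _ _ t10'.
  split=> // U V TE.
  have unitC (W : {poly {poly {fraction R}}}) :
      W != 0 -> is_constXY W -> W \is a GRing.unit.
    move=> W0 [a Wa]; move: W0; rewrite Wa !polyC_eq0 => a0.
    by rewrite !rmorph_unit // unitfE.
  have /andP[U0 V0] : (U != 0) && (V != 0).
    by rewrite -negb_or -mulf_eq0 -TE.
  suff [] : is_constXY U \/ is_constXY V.
  - by left; apply: unitC.
  - by right; apply: unitC.
  (* The embedding is injective, so degrees and nonvanishing at x = 1 and y = 1 are preserved, and
     [curve_num] commutes with it. *)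
  apply: (@factors_is_constXY _ n m (tofrac c)); rewrite -?TE //.
  - by rewrite tofrac_eq0.
  - rewrite curve_num_map // PT !rmorphM !rmorphXn rmorphB rmorph1 /=.
    by rewrite map_polyC map_polyX.
  - rewrite rootE -(rmorph1 (map_poly (@tofrac R))) horner_map.
    by rewrite (raddf_eq0 _ inj2).
  - rewrite /T' /map_polyXY swapXY_map rootE.
    by rewrite -(rmorph1 (map_poly (@tofrac R))) horner_map (raddf_eq0 _ inj2).
  - rewrite degY_swapXY /T' /map_polyXY swapXY_map /degX.
    rewrite !size_map_inj_poly ?rmorph0 //.
    by move: degT; rewrite degY_swapXY.
move=> [_ gcdT]; case: T0 => T0 Tu; split=> // U V TE.
(* A constant factor of T divides every coefficient, hence divides their gcd 1. *)
have unitC a : (forall i j, ring_divides a T`_i`_j) -> a%:P%:P \is a GRing.unit.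
  move=> ha; have [q /esym q1] := gcdT a (fun ij => ha ij.1 ij.2).
  rewrite !rmorph_unit //; apply/unitrP; exists q.
  by rewrite q1 mulrC q1.
case: (irrT U V TE) => -[a E]; [left|right]; rewrite E; apply: unitC => i j.
  by exists V`_i`_j; rewrite TE E !coefCM mulrC.
by exists U`_i`_j; rewrite TE E !coefMC.
Qed.
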